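(* Let $d\ge 4$ be a fixed integer. For all positive integers $N$ and all integers $m$ with $0\le m\le N^2/4$, $\mathrm{cr}_d(N,m)\in O(m^2/N)$. That is, there is a constant $C_d$ depending only on $d$ such that for all such $N$ and $m$ there is a (proper) $d$-dimensional geometric grid graph with exactly $m$ edges, volume at most $N$, and at most $C_d\,m^2/N$ crossings.
   Context: Let $\mathbb{N}=\{1,2,3,\dots\}$. For positive integers $X_1,\dots,X_d$, the $X_1\times\cdots\times X_d$ grid is the set $\{(x_1,\dots,x_d): x_i\in\{1,\dots,X_i\}\text{ for all }i\}\subset\mathbb{N}^d$; its volume is $\prod_{i=1}^d X_i$. A $d$-dimensional geometric grid graph $G$ is a finite simple graph whose vertex set is a subset of $\mathbb{N}^d$; each edge $uw$ is identified with the open straight line segment with endpoints $u$ and $w$. All geometric grid graphs are assumed to be proper: for every edge $uw\in E(G)$ and every vertex $x\in V(G)$, the point $x$ does not lie on the open segment $uw$. The volume $\mathrm{vol}(G)$ is the volume of the minimal $X_1\times\cdots\times X_d$ grid containing $V(G)$. Two distinct edges of $G$ cross (form a crossing) if, as open segments, they have a point in common; $\mathrm{cr}(G)$ is the number of crossings, i.e. of unordered pairs of distinct edges that cross. Define $\mathrm{cr}_d(N,m)=\min\{\mathrm{cr}(G): G\text{ is a }d\text{-dimensional (proper) geometric grid graph, } |E(G)|=m,\ \mathrm{vol}(G)\le N\}$. *)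

(* Defs.v *)
From mathcomp Require Import all_boot all_order all_algebra finmap.
From mathcomp Require Import boolp classical_sets reals.

Set Implicit Arguments.
Unset Strict Implicit.
Unset Printing Implicit Defensive.

Import Order.TTheory GRing.Theory Num.Theory.

Local Open Scope fset_scope.
Local Open Scope classical_set_scope.
Local Open Scope ring_scope.

(* Finite simple graphs on points of {1, 2, 3, ...}^d.  An edge is the
   unordered pair [fset u; w] of its two distinct endpoints. *)
Record grid_graph (d : nat) := GridGraph {
  vertices : {fset 'rV[nat]_d};
  edges : {fset {fset 'rV[nat]_d}};
  vertices_gt0 : forall x, x \in vertices -> forall i, (0 < x ord0 i)%N;
  edges_pair : forall e, e \in edges ->
    (e `<=` vertices)%fset /\ #|` e| = 2%N
}.

Definition grid (d : nat) (X : 'I_d -> nat) : set 'rV[nat]_d :=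
  [set x | forall i, (1 <= x ord0 i <= X i)%N].

(* The sides of the minimal grid containing the vertices.  The sides of a grid
   are positive, so the graph without vertices has the 1 x ... x 1 grid. *)
Definition side (d : nat) (G : grid_graph d) (i : 'I_d) : nat :=
  maxn 1 (\max_(x <- vertices G) x ord0 i).

Lemma sideP (d : nat) (G : grid_graph d) (X : 'I_d -> nat) :
  (forall i, 0 < X i)%N ->
  ((forall x, x \in vertices G -> grid X x) <-> forall i, (side G i <= X i)%N).
Proof.
move=> X0; split=> [GX i|GX x xG i].
- rewrite geq_max X0 /=; apply/bigmax_leqP_seq => x xG _.
  by have /andP[] := GX _ xG i.
- rewrite (vertices_gt0 xG) /=; apply: leq_trans (GX i).
  rewrite leq_max; apply/orP; right.
  exact: (@leq_bigmax_seq _ _ xpredT (fun y : 'rV[nat]_d => y ord0 i)).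
Qed.

Definition vol (d : nat) (G : grid_graph d) : nat := (\prod_i side G i)%N.

Section Crossings.
Variables (R : realType) (d : nat).

Definition embed (x : 'rV[nat]_d) : 'rV[R]_d := map_mx (fun n : nat => n%:R) x.

Definition open_segment (p q : 'rV[R]_d) : set 'rV[R]_d :=
  [set (1 - t) *: p + t *: q | t in [set t : R | 0 < t < 1]].

Definition edge_segment (e : {fset 'rV[nat]_d}) : set 'rV[R]_d :=
  [set p | exists u w : 'rV[nat]_d, [/\ u != w, e = [fset u; w]%fset
     & open_segment (embed u) (embed w) p]].

Definition proper_graph (G : grid_graph d) : Prop :=
  forall e x, e \in edges G -> x \in vertices G -> ~ edge_segment e (embed x).

Definition cross (e f : {fset 'rV[nat]_d}) : Prop :=
  e != f /\ edge_segment e `&` edge_segment f !=set0.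

Definition crossings (G : grid_graph d) : {fset {fset {fset 'rV[nat]_d}}} :=
  [fset P in fpowerset (edges G) |
    `[< exists e f, P = [fset e; f]%fset /\ cross e f >]]%fset.

Definition cr (G : grid_graph d) : nat := #|` crossings G|.

Definition admissible (N m : nat) (G : grid_graph d) : Prop :=
  [/\ proper_graph G, #|` edges G| = m & (vol G <= N)%N].

(* The relation "cr_d(N, m) = k".  It is a relation because the minimum is over
   the empty set when m is too large for N. *)
Definition is_cr_d (N m k : nat) : Prop :=
  (exists G : grid_graph d, admissible N m G /\ cr G = k) /\
  (forall G : grid_graph d, admissible N m G -> (k <= cr G)%N).

End Crossings.

Arguments is_cr_d : clear implicits.

(* Main.v *)
Require Import Defs.
From mathcomp Require Import all_boot all_order all_algebra finmap.
From mathcomp Require Import boolp classical_sets reals.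
From mathcomp Require Import zify ring lra.

(** It is enough to find, for each [N], one proper graph of volume at most [N] with
    at least [N ^ 2 / 4] edges (rounded down) and [O(N ^ 3)] crossings.  A random
    subset of [m] of its [E] edges keeps each crossing with probability
    [m (m - 1) / (E (E - 1))], hence has [O(m ^ 2 / N)] crossings on average, and
    some subset does at least as well ([thinning]).  The finitely many [N] for
    which the orders of magnitude below mean nothing only affect the constant.

    The dense graph lives in two adjacent layers, each a [K * K * C] box with
    [K] of order [N ^ (1/4)] and [C] of order [N ^ (1/2)], and contains every edge
    from one layer to the other.  With [n = K ^ 2 C] close to [N / 2] this gives
    [n ^ 2] edges.  Rounding loses [O(N K ^ 2)] edges; they are recovered from
    edges inside a layer, so few that even if all pairs of them crossed there
    would be only [O(N ^ 2 K ^ 4) = O(N ^ 3)] crossings.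

    It remains to count crossings of edges [p q] and [p' q'] between the layers
    ([card_steep_meetings]).  They meet at a common parameter [g / (g + h)] with
    [g] and [h] coprime, and [h p + g q = h p' + g q'] in each coordinate.  By
    symmetry let [h <= g].  Then [p] and [p'] are congruent modulo [g], and [p],
    [p'], [q], [g], [h] determine [q'].  So for each [g] there are at most
    [g n ^ 2] times the size of a residue class modulo [g] in the box.  For
    [g <= K] that size is [O(n / g ^ 3)], and for [K < g < C] it is [O(C / g)].
    Summing over [g] gives [O(n ^ 2 (n + C ^ 2)) = O(n ^ 3)].  The convergence of
    [\sum_g 1 / g ^ 2] is where three coordinates besides the layer are used. *)

Set Implicit Arguments.
Unset Strict Implicit.
Unset Printing Implicit Defensive.

Import Order.TTheory GRing.Theory Num.Theory.

(** * Thinning a relation *)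

Definition related_pairs (I : finType) (r : rel I) (S : {set I}) : {set I * I} :=
  [set ij in finset.setX S S | r ij.1 ij.2].

Lemma related_pairs_le1 (I : finType) (r : rel I) (S : {set I}) :
  irreflexive r -> (#|S| <= 1)%N -> #|related_pairs r S| = 0%N.
Proof.
move=> irr /card_le1_eqP S1; apply/eqP; rewrite cards_eq0 -finset.subset0.
apply/fintype.subsetP=> -[i j]; rewrite !inE /= => /andP[/andP[iS jS]].
by rewrite (S1 _ _ iS jS) irr.
Qed.

(** A related pair consists of two distinct elements of [D], so it survives the
    deletion of exactly [#|D| - 2] of them. *)
Lemma sum_related_pairs_setD1 (I : finType) (r : rel I) (D : {set I}) :
  irreflexive r ->
  (\sum_(e in D) #|related_pairs r (D :\ e)| = #|related_pairs r D| * (#|D| - 2))%N.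
Proof.
move=> irr.
transitivity (\sum_(e in D) \sum_(ij in related_pairs r D)
                 ((e != ij.1) && (e != ij.2) : nat))%N.
  apply: eq_bigr => e eD; rewrite -sum1_card big_mkcond [RHS]big_mkcond /=.
  apply: eq_bigr => -[i j] _; rewrite !inE /= (eq_sym i) (eq_sym j).
  by case: (e != i); case: (e != j); case: (i \in D); case: (j \in D); case: (r i j).
rewrite exchange_big /= -sum_nat_const; apply: eq_bigr => -[i j].
rewrite !inE /= => /andP[/andP[iD jD] rij].
have ij : i != j by apply: contraTneq rij => ->; rewrite irr.
rewrite (cardsD1 i D) iD (cardsD1 j (D :\ i)) !inE eq_sym ij jD /= add1n add1n.
rewrite !subSS subn0 -sum1_card [LHS]big_mkcond [RHS]big_mkcond /=.
by apply: eq_bigr => e _; rewrite !inE; case: (e \in D); case: (e == i); case: (e == j).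
Qed.

(** Some deletion does at least as well as the average over [D]. *)
Lemma delete_one (I : finType) (r : rel I) (D : {set I}) :
  irreflexive r -> (0 < #|D|)%N ->
  exists2 e, e \in D &
    (#|related_pairs r (D :\ e)| * #|D| <= #|related_pairs r D| * (#|D| - 2))%N.
Proof.
move=> irr D0; apply/exists_inP/contraT => /exists_inPn noe.
have : (\sum_(e in D) (#|related_pairs r D| * (#|D| - 2)).+1 <=
   \sum_(e in D) #|related_pairs r (D :\ e)| * #|D|)%N.
  by apply: leq_sum => e eD; rewrite ltnNge noe.
rewrite -big_distrl /= sum_related_pairs_setD1 // sum_nat_const [leqRHS]mulnC.
by rewrite leq_pmul2l // ltnn.
Qed.

(** Thinning to [m] elements costs no more than passing to a random [m]-subset,
    in which a given pair survives with probability
    [m (m - 1) / (#|D| (#|D| - 1))].  Deleting one well chosen element at a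
    time never increases the ratio of the number of related pairs to
    [#|D| (#|D| - 1)]. *)
Lemma thinning (I : finType) (r : rel I) (D : {set I}) (m : nat) :
  irreflexive r -> (m <= #|D|)%N ->
  exists S : {set I}, [/\ S \subset D, #|S| = m &
    (#|related_pairs r S| * (#|D| * (#|D| - 1)) <=
     #|related_pairs r D| * (m * (m - 1)))%N].
Proof.
move=> irr; move Dk: #|D| => k; elim: k D Dk => [|k IH] D Dk.
  by rewrite leqn0 => /eqP->; exists D; rewrite Dk subxx.
rewrite leq_eqVlt => /predU1P[->|]; first by exists D; rewrite Dk subxx.
rewrite ltnS => mk.
have [|e eD le_e] := @delete_one _ r D irr; first by rewrite Dk.
have De : #|D :\ e| = k by move: Dk; rewrite (cardsD1 e) eD => -[].
have [S [SD Sm leS]] := IH _ De mk.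
exists S; split=> //; first exact: fintype.subset_trans SD (finset.subD1set _ _).
have [m1|m2] := leqP m 1; first by rewrite related_pairs_le1 ?Sm.
rewrite Dk in le_e.
rewrite -(@leq_pmul2l (k - 1)) ?subn_gt0 ?(leq_trans m2) //.
rewrite subSS subn0; rewrite subSS in le_e.
move: leS le_e; move: #|_| #|_| #|_| (m * _)%N (k - 1)%N => a b c u v leS le_e.
apply: (@leq_trans (b * u * k.+1)%N).
  by have := leq_mul leS (leqnn k.+1); nia.
by have := leq_mul le_e (leqnn u); nia.
Qed.

(** * Segments between two boxes that meet *)

(** This is [\sum_g 1 / g ^ 2 <= 2] with the denominators cleared. *)
Lemma sum_inverse_square (A m : nat) (a : nat -> nat) :
  (forall g, 0 < g < m -> a g * g ^ 2 <= A)%N ->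
  (\sum_(1 <= g < m) a g <= 2 * A)%N.
Proof.
case: m => [|m] aA; first by rewrite big_geq.
case: m => [|m] in aA *; first by rewrite big_geq.
(* The stronger bound [A (2 - 1 / (m + 1))] on the partial sum is inductive. *)
suff H : ((\sum_(1 <= g < m.+2) a g) * m.+1 + A <= 2 * A * m.+1)%N.
  by rewrite -(@leq_pmul2r m.+1) //; apply: leq_trans (leq_addr _ _) H.
elim: m => [|m IH] in aA *.
  by rewrite big_nat1; have := aA 1%N isT; lia.
rewrite big_nat_recr //=.
have {}IH : ((\sum_(1 <= g < m.+2) a g) * m.+1 + A <= 2 * A * m.+1)%N.
  by apply: IH => g gm; apply: aA; lia.
have := aA m.+2; rewrite ltnS leqnn => /(_ isT).
move: (a _) (\sum_(1 <= g < _) _)%N IH => b s IH bA.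
rewrite -(@leq_pmul2r m.+1) //; have := leq_mul IH (leqnn m.+2).
have : (b * m.+2 * m.+1 <= A)%N by apply: leq_trans bA; rewrite -mulnA leq_mul2l; nia.
by nia.
Qed.

(** The ceiling of [K / g] for positive [K]: the largest size of a residue class
    modulo [g] among [K] consecutive integers. *)
Definition residue_cap (K g : nat) : nat := (K.-1 %/ g).+1.

Lemma card_congruent (K g : nat) :
  (0 < g)%N ->
  (#|[set xy : 'I_K * 'I_K | xy.1 == xy.2 %[mod g]]| <= K * residue_cap K g)%N.
Proof.
move=> g0; pose f (xy : 'I_K * 'I_K) : 'I_K * 'I_(residue_cap K g) :=
  (xy.1, inord (xy.2 %/ g)).
have fE (xy : 'I_K * 'I_K) : (f xy).2 = (xy.2 %/ g)%N :> nat.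
  by rewrite inordK // ltnS leq_div2r // -ltnS (ltn_predK (ltn_ord xy.2)).
have finj : {in [set xy : 'I_K * 'I_K | xy.1 == xy.2 %[mod g]] &, injective f}.
  move=> [x y] [x' y'] /[!inE] /= /eqP xy /eqP xy' [xx yy].
  have /= yy' := fE (x, y); have /= yy'' := fE (x', y').
  rewrite /f /= in yy' yy''; rewrite yy yy'' in yy'.
  congr (_, _); first exact: xx.
  apply/val_inj => /=; rewrite (divn_eq y g) (divn_eq y' g) yy' -xy -xy'.
  by rewrite xx.
rewrite -(card_in_imset finj).
by apply: leq_trans (max_card _) _; rewrite card_prod !card_ord.
Qed.

Lemma residue_cap_mul (K g : nat) :
  (0 < K)%N -> (g <= K)%N -> (g * residue_cap K g <= 2 * K)%N.
Proof. by rewrite /residue_cap => K0 gK; have := leq_trunc_div K.-1 g; nia. Qed.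

Lemma residue_cap_ge (K g : nat) : (0 < K)%N -> (K <= g)%N -> residue_cap K g = 1%N.
Proof. by move=> K0 Kg; rewrite /residue_cap divn_small //; lia. Qed.

(** For [g <= K] both ceilings are at most twice the true quotients and the
    summand is at most [8 K ^ 2 C / g ^ 2]; for [g > K] the first ceiling is 1 and
    the summand is at most [2 C].  The exponent 2, which comes from two short
    directions besides the long one, is what makes the first part converge; a
    single short direction would give a harmonic sum and lose a logarithm. *)
Lemma sum_residue_caps (K C : nat) :
  (0 < K)%N -> (0 < C)%N ->
  (\sum_(1 <= g < C) g * (residue_cap K g ^ 2 * residue_cap C g)
    <= 16 * (K ^ 2 * C) + 2 * C ^ 2)%N.
Proof.
move=> K0 C0; pose t g := (g * (residue_cap K g ^ 2 * residue_cap C g))%N.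
apply: (@leq_trans (\sum_(1 <= g < C) ((if (g <= K)%N then t g else 0) + 2 * C))%N).
  rewrite big_nat_cond [leqRHS]big_nat_cond; apply: leq_sum => g /andP[/andP[g1 gC] _].
  rewrite -/(t g); case: (leqP g K) => [_|Kg]; first exact: leq_addr.
  rewrite /t (residue_cap_ge K0 (ltnW Kg)) exp1n mul1n.
  by apply: residue_cap_mul; lia.
rewrite big_split /= leq_add //.
  apply: leq_trans (@sum_inverse_square (8 * (K ^ 2 * C)) C _ _) _; last by lia.
  move=> g /andP[g0 gC]; case: (leqP g K) => // gK; rewrite /t.
  have := residue_cap_mul K0 gK; have := residue_cap_mul C0 (ltnW gC).
  move: (residue_cap _ _) (residue_cap _ _) => c k cC kK.
  by have := leq_mul (leq_mul kK kK) cC; lia.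
by rewrite sum_nat_const_nat; nia.
Qed.

Local Notation box K C := ('I_K * 'I_K * 'I_C)%type.

(** The segments from [a] to [b] and from [c] to [e] have the same value at the
    parameter [g / (g + h)], denominators cleared. *)
Definition balanced (g h a b c e : nat) : bool :=
  (h * a + g * b == h * c + g * e)%N.

Definition meet_at (g h : nat) (K C : nat) (e f : box K C * box K C) : bool :=
  [&& balanced g h e.1.1.1 e.2.1.1 f.1.1.1 f.2.1.1,
      balanced g h e.1.1.2 e.2.1.2 f.1.1.2 f.2.1.2 &
      balanced g h e.1.2 e.2.2 f.1.2 f.2.2].

Lemma balanced_mod (g h a b c d : nat) :
  coprime g h -> balanced g h a b c d -> (a == c %[mod g])%N.
Proof.
move=> co /eqP E.
have : (h * a == h * c %[mod g])%N.
  rewrite -(modnMDl b (h * a) g) -(modnMDl d (h * c) g).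
  by apply/eqP; congr (_ %% _)%N; lia.
wlog ac : a b c d {E} / (c <= a)%N.
  move=> W; have [ca|/ltnW ac] := leqP c a; first exact: (W a b c d).
  by rewrite eq_sym [in X in _ -> X]eq_sym; apply: (W c d a b).
rewrite eqn_mod_dvd ?leq_mul // eqn_mod_dvd // -mulnBr Gauss_dvdr //.
Qed.

Lemma balanced_inj (g h a b c d d' : nat) :
  (0 < g)%N -> balanced g h a b c d -> balanced g h a b c d' -> d = d'.
Proof.
move=> g0 /eqP E /eqP E'; apply/eqP; rewrite -(eqn_pmul2l g0).
by rewrite -(eqn_add2l (h * c)) -E -E'.
Qed.

(** The pair of first ends and the second end of the first segment determine
    everything, and the two first ends are congruent modulo [g] in each
    coordinate. *)
Lemma card_meet_at (K C g h : nat) :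
  (0 < g)%N -> coprime g h ->
  (#|[set ef : (box K C * box K C) * (box K C * box K C) | meet_at g h ef.1 ef.2]|
   <= (K ^ 2 * C) ^ 2 * (residue_cap K g ^ 2 * residue_cap C g))%N.
Proof.
move=> g0 co; set S := [set ef | _].
pose cong n := [set xy : 'I_n * 'I_n | xy.1 == xy.2 %[mod g]].
pose F (ef : (box K C * box K C) * (box K C * box K C)) :=
  (((ef.1.1.1.1, ef.2.1.1.1), (ef.1.1.1.2, ef.2.1.1.2), (ef.1.1.2, ef.2.1.2)), ef.1.2).
have Finj : {in S &, injective F}.
  move=> [[[[a1 a2] a3] [[b1 b2] b3]] [[[c1 c2] c3] [[d1 d2] d3]]].
  move=> [[[[a1' a2'] a3'] [[b1' b2'] b3']] [[[c1' c2'] c3'] [[d1' d2'] d3']]].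
  rewrite !inE /meet_at /= => /and3P[B1 B2 B3] /and3P[B1' B2' B3'] [].
  move=> ? ? ? ? ? ? ? ? ?; subst.
  by rewrite (ord_inj (balanced_inj g0 B1 B1')) (ord_inj (balanced_inj g0 B2 B2'))
             (ord_inj (balanced_inj g0 B3 B3')).
rewrite -(card_in_imset Finj).
apply: (@leq_trans #|finset.setX
  (finset.setX (finset.setX (cong K) (cong K)) (cong C)) [set: box K C]|).
  apply/subset_leq_card/fintype.subsetP => _ /imsetP[[[a b] [c d]] + ->].
  rewrite !inE /meet_at /= => /and3P[B1 B2 B3].
  by rewrite (balanced_mod co B1) (balanced_mod co B2) (balanced_mod co B3).
rewrite !cardsX cardsT !card_prod !card_ord.
have cK := card_congruent K g0; have cC := card_congruent C g0.
have := leq_mul (leq_mul (leq_mul cK cK) cC) (leqnn (K * K * C)).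
move/leq_trans; apply; lia.
Qed.

(** Meetings whose parameter [g / (g + h)] is at least one half.  The others become
    of this kind when the two segments are reversed, which exchanges [g] and [h].
    The larger weight [g] is the one for which congruence is a strong
    restriction, so that the sum over [h <= g] costs a mere factor [g]. *)
Definition steep_meetings (K C : nat) :
    {set (box K C * box K C) * (box K C * box K C)} :=
  [set ef | (ef.1.1 != ef.2.1) &&
     [exists g : 'I_C, [exists h : 'I_C,
        [&& (0 < h <= g)%N, coprime g h & meet_at g h ef.1 ef.2]]]].

Lemma card_bigcup_le (I T : finType) (P : pred I) (A : I -> {set T}) :
  (#|\bigcup_(i | P i) A i| <= \sum_(i | P i) #|A i|)%N.
Proof.
elim/big_rec2: _ => [|i m B _ le]; first by rewrite cards0.
by apply: leq_trans (leq_card_setU _ _) _; rewrite leq_add2l.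
Qed.

Lemma card_steep_meetings (K C : nat) :
  (0 < K)%N -> (0 < C)%N ->
  (#|steep_meetings K C| <= (K ^ 2 * C) ^ 2 * (16 * (K ^ 2 * C) + 2 * C ^ 2))%N.
Proof.
move=> K0 C0.
pose M (g h : nat) := [set ef : (box K C * box K C) * (box K C * box K C) |
   meet_at g h ef.1 ef.2].
apply: (@leq_trans #|\bigcup_(g : 'I_C)
    \bigcup_(h : 'I_C | (0 < h <= g)%N && coprime g h) M g h|).
  apply/subset_leq_card/fintype.subsetP => ef; rewrite inE => /andP[_].
  case/existsP => g /existsP[h /and3P[hg co mt]].
  by apply/finset.bigcupP; exists g => //; apply/finset.bigcupP; exists h; rewrite ?hg ?inE.
apply: leq_trans (leq_mul (leqnn _) (sum_residue_caps K0 C0)).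
apply: leq_trans (card_bigcup_le _ _) _.
rewrite big_distrr /= -(big_mkord xpredT (fun g =>
  #|\bigcup_(h : 'I_C | (0 < h <= g)%N && coprime g h) M g h|)).
have none : (\bigcup_(h : 'I_C | (0 < h <= 0)%N && coprime 0 h) M 0 h = finset.set0)%N.
  by apply: big_pred0 => -[[|h] hC].
rewrite big_ltn // none cards0 add0n.
rewrite big_nat_cond [leqRHS]big_nat_cond; apply: leq_sum => g /andP[/andP[g1 gC] _].
apply: leq_trans (card_bigcup_le _ _) _.
apply: (@leq_trans (\sum_(h : 'I_C | (0 < h <= g)%N)
    (K ^ 2 * C) ^ 2 * (residue_cap K g ^ 2 * residue_cap C g))%N).
  rewrite big_mkcondr /=; apply: leq_sum => h _; case: ifP => // co.
  exact: card_meet_at.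
rewrite sum_nat_const mulnCA leq_mul2l; apply/orP; right.
rewrite leq_mul2r; apply/orP; right.
have hinj : {in [pred h : 'I_C | (0 < h <= g)%N] &,
    injective (fun h : 'I_C => inord h.-1 : 'I_g.-1.+1)}.
  move=> h h' /andP[h0 hg] /andP[h0' hg'] /(congr1 val) /=.
  rewrite !inordK ?prednK // => E; apply/val_inj => /=; lia.
by rewrite -(card_in_image hinj); apply: leq_trans (max_card _) _; rewrite card_ord prednK.
Qed.

(** * Grid graphs from finite types of points *)

Local Open Scope ring_scope.

Definition edge_of (d : nat) (T : Type) (pos : T -> 'rV[nat]_d) (e : T * T) :
  {fset 'rV[nat]_d} := [fset pos e.1; pos e.2]%fset.

Lemma fset2_inj (T : choiceType) (a b c e : T) :
  [fset a; b]%fset = [fset c; e]%fset -> (a = c /\ b = e) \/ (a = e /\ b = c).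
Proof.
move/fsetP => E; have := (E a, E b, E c, E e); rewrite !inE !eqxx ?orbT.
case=> -[[/esym/orP[]/eqP-> /esym/orP[]/eqP->]].
- by move=> _ /orP[]/eqP->; left.
- by left.
- by right.
- by move=> /orP[]/eqP-> _; right.
Qed.

Section EdgeSegments.
Variables (R : realType) (d : nat).
Implicit Types (u w : 'rV[nat]_d) (x : 'rV[R]_d).

(** An edge does not remember which end comes first; reversing it replaces [t] by
    [1 - t], so a parametrisation exists for either orientation. *)
Lemma edge_segmentP u w x : edge_segment [fset u; w]%fset x ->
  exists2 t : R, 0 < t < 1 & forall i, x ord0 i = (1 - t) * (u ord0 i)%:R + t * (w ord0 i)%:R.
Proof.
case=> u' [w' [_ /fset2_inj E [t /= t01 <-]]].
case: E => -[-> ->]; first by exists t => // i; rewrite !mxE.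
by exists (1 - t) => [|i]; [lra | rewrite !mxE; ring].
Qed.

Lemma nat_not_between (a n : nat) (t : R) :
  0 < t < 1 -> n%:R <> (1 - t) * a%:R + t * a.+1%:R :> R.
Proof.
move=> t01 E; have {}E : n%:R = a%:R + t by rewrite E -addn1 natrD; ring.
have : (a < n)%N by rewrite -(ltr_nat R); lra.
have : (n < a.+1)%N by rewrite -(ltr_nat R) -addn1 natrD; lra.
by rewrite ltnS => na /leq_trans /(_ na); rewrite ltnn.
Qed.
End EdgeSegments.

(** Graphs are built from a finite type of points, so that edges can be counted as
    oriented pairs in [T * T]; [S_asym] keeps the passage to unordered pairs
    injective. *)
Section PlacedGraph.
Variables (R : realType) (d : nat) (T : finType) (pos : T -> 'rV[nat]_d).
Hypothesis pos_inj : injective pos.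
Hypothesis pos_gt0 : forall t i, (0 < pos t ord0 i)%N.

Definition placed_cross : rel (T * T) :=
  fun e f => `[< cross R (edge_of pos e) (edge_of pos f) >].

Lemma placed_cross_irr : irreflexive placed_cross.
Proof. by move=> e; apply/asboolP => -[]; rewrite eqxx. Qed.

Variable S : {set T * T}.
Hypothesis S_step : forall p q, (p, q) \in S ->
  exists i, pos q ord0 i = (pos p ord0 i).+1.
Hypothesis S_asym : forall p q, (p, q) \in S -> (q, p) \notin S.

Lemma edge_of_inj : {in S &, injective (edge_of pos)}.
Proof.
move=> [p q] [p' q'] pqS pqS' /fset2_inj /= [] [/pos_inj E1 /pos_inj E2].
  by rewrite E1 E2.
by have := S_asym pqS; rewrite E1 E2 pqS'.
Qed.

Definition placed_vertices : {fset 'rV[nat]_d} := [fset pos t | t in T]%fset.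
Definition placed_edges : {fset {fset 'rV[nat]_d}} :=
  [fset edge_of pos e | e in S]%fset.

Lemma placed_vertices_gt0 x :
  x \in placed_vertices -> forall i, (0 < x ord0 i)%N.
Proof. by case/imfsetP => t _ -> i. Qed.

Lemma placed_edges_pair e : e \in placed_edges ->
  (e `<=` placed_vertices)%fset /\ #|` e|%fset = 2%N.
Proof.
case/imfsetP => -[p q] pqS ->; split.
  by apply/fsubsetP => x; rewrite !inE => /orP[] /eqP->; apply: in_imfset.
rewrite cardfs2; case: eqVneq => //= /pos_inj E.
by have := S_asym pqS; rewrite E; rewrite /= in pqS; rewrite E in pqS; rewrite pqS.
Qed.

Definition placed_graph : grid_graph d :=
  GridGraph placed_vertices_gt0 placed_edges_pair.

(** An edge advancing by 1 along some axis has no lattice point in its interior. *)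
Lemma placed_graph_proper : proper_graph R placed_graph.
Proof.
move=> e x /imfsetP[[p q] pqS ->] _ /edge_segmentP[t t01 E].
have [i Ei] := S_step pqS; have := E i; rewrite mxE Ei.
exact: nat_not_between.
Qed.

Lemma card_placed_edges : #|` edges placed_graph|%fset = #|S|.
Proof. by rewrite /= card_in_imfset ?cardE //; apply: edge_of_inj. Qed.

Lemma cr_placed_graph : (cr R placed_graph <= #|related_pairs placed_cross S|)%N.
Proof.
apply: (@leq_trans #|` [fset [fset edge_of pos ef.1; edge_of pos ef.2]%fset
    | ef in related_pairs placed_cross S]|%fset); last first.
  by rewrite cardE; apply: leq_imfset_card.
apply/fsubset_leq_card/fsubsetP => P; rewrite !inE => /andP[].
rewrite fpowersetE => sub /asboolP[e [f [E ef]]].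
have /imfsetP[e' e'S Ee] : e \in placed_edges by apply: (fsubsetP sub); rewrite E !inE eqxx.
have /imfsetP[f' f'S Ef] : f \in placed_edges by apply: (fsubsetP sub); rewrite E !inE eqxx orbT.
apply/imfsetP; exists (e', f'); last by rewrite E Ee Ef.
by rewrite /= !inE /= e'S f'S; apply/asboolP; rewrite -Ee -Ef.
Qed.

Lemma vol_placed_graph (X : 'I_d -> nat) :
  (forall i, 0 < X i)%N -> (forall t i, pos t ord0 i <= X i)%N ->
  (vol placed_graph <= \prod_i X i)%N.
Proof.
move=> X0 posX; apply: leq_prod => i _; move: i; apply/sideP => //.
by move=> x /imfsetP[t _ ->] i; rewrite pos_gt0 posX.
Qed.
End PlacedGraph.

(** * The parameter of a crossing *)

(** The parameter [t] solves a nontrivial linear equation with integer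
    coefficients; [g] and [h] are those coefficients in lowest terms, so that
    [t = g / (g + h)]. *)
Lemma rational_crossing (R : realType) (t : R) (a b c e : nat) :
  0 < t < 1 -> a != c ->
  (1 - t) * a%:R + t * b%:R = (1 - t) * c%:R + t * e%:R ->
  exists g h : nat, [/\ (0 < g)%N, (0 < h)%N, coprime g h & (1 - t) * g%:R = t * h%:R].
Proof.
move=> t01.
wlog ac : a b c e / (c < a)%N.
  move=> W ac E; have [ca|ac'|E'] := ltngtP c a; first exact: (W a b c e).
    by apply: (W c e a b) => //; rewrite eq_sym.
  by rewrite E' eqxx in ac.
move=> _ E; have ac' : c%:R < a%:R :> R by rewrite ltr_nat.
have be : (b < e)%N by rewrite -(ltr_nat R); nra.
pose k := gcdn (a - c) (e - b).
have k0 : (0 < k)%N by rewrite gcdn_gt0 subn_gt0 ac.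
have [g Eg] := dvdnP (dvdn_gcdl (a - c) (e - b)).
have [h Eh] := dvdnP (dvdn_gcdr (a - c) (e - b)).
rewrite -/k in Eg Eh; exists g, h; split.
- by case: g Eg => //; lia.
- by case: h Eh => //; lia.
- by rewrite /coprime -(eqn_pmul2r k0) muln_gcdl -Eg -Eh mul1n.
- have kR : k%:R != 0 :> R by rewrite pnatr_eq0 -lt0n.
  apply: (mulIf kR); rewrite -!mulrA -!natrM -Eg -Eh.
  by rewrite !natrB ?(ltnW ac) ?(ltnW be) //; lra.
Qed.

Lemma balanced_sym (g h a b c e : nat) :
  balanced g h a b c e = balanced h g b a e c.
Proof. by rewrite /balanced addnC (addnC (h * c)%N). Qed.

Lemma crossing_balanced (R : realType) (t : R) (g h a b c e : nat) :
  0 < t < 1 -> (1 - t) * g%:R = t * h%:R ->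
  (1 - t) * a%:R + t * b%:R = (1 - t) * c%:R + t * e%:R ->
  balanced g h a b c e.
Proof.
move=> t01 Egh E; rewrite /balanced -(eqr_nat R) !natrD !natrM.
have t1 : 1 - t != 0 by lra.
apply/eqP/(mulfI t1); rewrite !mulrDr !mulrA Egh.
have := congr1 (fun x => x * h%:R) E => /= {}E.
transitivity (((1 - t) * a%:R + t * b%:R) * h%:R); first by ring.
by rewrite E; ring.
Qed.

(** * The two-layer graph *)

(** With two layers, the long edges nearly suffice: their number is a quarter of
    the square of the number of points.  The short edges make up for the points
    lost when [N] is not exactly [2 K ^ 2 C].  Both kinds advance by 1 along some
    axis, which makes every graph formed by them proper. *)
Section BoxEdges.
Variables (L K C : nat).

Local Notation point := ('I_L * box K C)%type.

Definition long (e : point * point) : bool :=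
  (e.1.1 == 0%N :> nat) && (e.2.1 == 1%N :> nat).

Definition short (e : point * point) : bool :=
  (e.1.1 == e.2.1) && (e.2.2.2 == e.1.2.2.+1 :> nat).

Definition box_edges : {set point * point} := [set e | long e || short e].

Lemma box_edges_asym p q : (p, q) \in box_edges -> (q, p) \notin box_edges.
Proof.
rewrite !inE /long /short /= -!(inj_eq val_inj) /=.
by apply/contraTN; lia.
Qed.

Lemma card_short_le : (#|[set e | short e]| <= L * (K ^ 2 * C) * K ^ 2)%N.
Proof.
pose F (e : point * point) := (e.1, e.2.2.1).
have Finj : {in [set e | short e] &, injective F}.
  move=> [[l p] [l' [[x y] z]]] [[m p'] [m' [[x' y'] z']]].
  rewrite !inE => /andP[/eqP/= -> /eqP/= E] /andP[/eqP/= -> /eqP/= E'] [-> Ep -> ->].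
  by rewrite (ord_inj (_ : z = z' :> nat)) ?E ?E' Ep.
rewrite -(card_in_imset Finj); apply: leq_trans (max_card _) _.
by rewrite !card_prod !card_ord; lia.
Qed.

Lemma card_long_ge : L = 2 -> ((K ^ 2 * C) ^ 2 <= #|[set e | long e]|)%N.
Proof.
move=> EL; have i0 : (0 < L)%N by rewrite EL. have i1 : (1 < L)%N by rewrite EL.
pose F (e : box K C * box K C) : point * point :=
  ((Ordinal i0, e.1), (Ordinal i1, e.2)).
have Finj : injective F by move=> [p q] [p' q'] [-> ->].
apply: (@leq_trans #|F @: [set: box K C * box K C]|).
  by rewrite card_imset // cardsT !card_prod !card_ord; lia.
by apply/subset_leq_card/fintype.subsetP => _ /imsetP[e _ ->]; rewrite inE.
Qed.

Lemma card_short_ge : (L * K ^ 4 * C.-1 <= #|[set e | short e]|)%N.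
Proof.
have zC (z : 'I_C.-1) : (z.+1 < C)%N by have := ltn_ord z; lia.
pose F (u : 'I_L * ('I_K * 'I_K) * ('I_K * 'I_K) * 'I_C.-1) : point * point :=
  ((u.1.1.1, (u.1.1.2, Ordinal (ltnW (zC u.2)))),
   (u.1.1.1, (u.1.2, Ordinal (zC u.2)))).
have Finj : injective F.
  by move=> [[[l [x y]] [x' y']] z] [[[l' [u v]] [u' v']] w] [-> -> -> /ord_inj-> _ -> ->].
apply: (@leq_trans #|F @: [set: 'I_L * ('I_K * 'I_K) * ('I_K * 'I_K) * 'I_C.-1]|).
  by rewrite card_imset // cardsT !card_prod !card_ord; lia.
by apply/subset_leq_card/fintype.subsetP => _ /imsetP[e _ ->]; rewrite inE /short /= !eqxx.
Qed.

Lemma card_box_edges_ge : (0 < L <= 2)%N ->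
  ((L - 1) * (K ^ 2 * C) ^ 2 + L * K ^ 4 * C.-1 <= #|box_edges|)%N.
Proof.
have -> : #|box_edges| = (#|[set e | long e]| + #|[set e | short e]|)%N.
  rewrite -cardsUI [X in (_ + X)%N](_ : _ = 0%N) ?addn0.
    by apply: eq_card => e; rewrite !inE.
  apply/eqP; rewrite cards_eq0 -finset.subset0; apply/fintype.subsetP => e.
  by rewrite !inE /long /short -!(inj_eq val_inj) /=; lia.
move=> L02; apply: leq_add card_short_ge.
have [EL|L1] : (L = 2 \/ L - 1 = 0)%N by lia.
  by rewrite {1}EL mul1n card_long_ge.
by rewrite L1.
Qed.

End BoxEdges.

Section BoxGraph.
Variables (R : realType) (d : nat) (hd : (4 <= d)%N) (L K C : nat).
Hypotheses (L2 : (L <= 2)%N) (K0 : (0 < K)%N) (KC : (K ^ 2 <= C)%N).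

Local Notation point := ('I_L * box K C)%type.

Definition coord (p : point) (k : nat) : nat :=
  match k with
  | 0 => p.1 | 1 => p.2.1.1 | 2 => p.2.1.2 | 3 => p.2.2 | _ => 0
  end.

Definition box_side (k : nat) : nat :=
  match k with 0 => L | 1 | 2 => K | 3 => C | _ => 1 end.

Definition place (p : point) : 'rV[nat]_d := \row_i (coord p i).+1.

(** The hypothesis [4 <= d] enters here: the layer and the three coordinates of
    the box need four axes. *)
Lemma place_axis (k : nat) : (k < 4)%N ->
  exists i : 'I_d, forall p, place p ord0 i = (coord p k).+1.
Proof.
by move=> k4; exists (widen_ord hd (Ordinal k4)) => p; rewrite mxE.
Qed.

Lemma coord_inj (p q : point) : (forall k, (k < 4)%N -> coord p k = coord q k) -> p = q.
Proof.
case: p q => [l [[x y] z]] [l' [[x' y'] z']] E.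
have := (E 0%N isT, E 1%N isT, E 2%N isT, E 3%N isT) => /=.
by case=> -[[/ord_inj-> /ord_inj->] /ord_inj->] /ord_inj->.
Qed.

Lemma place_inj : injective place.
Proof.
move=> p q E; apply: coord_inj => k k4; have [i pi] := place_axis k4.
by apply: succn_inj; rewrite -!pi E.
Qed.

Lemma place_gt0 (p : point) i : (0 < place p ord0 i)%N.
Proof. by rewrite mxE. Qed.

Lemma place_le (p : point) i : (place p ord0 i <= box_side i)%N.
Proof.
by rewrite mxE; case: (i : nat) => [|[|[|[|k]]]] /=; rewrite ?ltn_ord.
Qed.

Lemma prod_box_side : (\prod_(i < d) box_side i = L * (K ^ 2 * C))%N.
Proof.
case: d hd => [|[|[|[|d']]]] // _.
by rewrite !big_ord_recl /= big1 ?muln1 -?mulnn -?mulnA.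
Qed.

Lemma box_edges_step p q : (p, q) \in box_edges L K C ->
  exists i, place q ord0 i = (place p ord0 i).+1.
Proof.
rewrite inE => /orP[/andP[/eqP/= E /eqP/= E']|/andP[_ /eqP/= E]].
  have [i pi] := place_axis (isT : (0 < 4)%N).
  by exists i; rewrite !pi /= E E'.
have [i pi] := place_axis (isT : (3 < 4)%N).
by exists i; rewrite !pi /= E.
Qed.

Definition ends (e : point * point) : box K C * box K C := (e.1.2, e.2.2).

Lemma placed_crossP e f : placed_cross R place e f ->
  exists t s : R, [/\ 0 < t < 1, 0 < s < 1 &
    forall k, (k < 4)%N ->
      (1 - t) * (coord e.1 k)%:R + t * (coord e.2 k)%:R =
      (1 - s) * (coord f.1 k)%:R + s * (coord f.2 k)%:R].
Proof.
case/asboolP=> _ [x [/edge_segmentP[t t01 Et] /edge_segmentP[s s01 Es]]].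
exists t, s; split=> // k k4; have [i pi] := place_axis k4.
by have := Et i; rewrite Es !pi -!natr1; lra.
Qed.

(** A short edge has a constant integer first coordinate, while the interior of a
    long edge lies strictly between the two layers. *)
Lemma long_short_no_cross e f : long e -> short f ->
  ~~ placed_cross R place e f && ~~ placed_cross R place f e.
Proof.
move=> /andP[/eqP e1 /eqP e2] /andP[/eqP f12 _].
have no t s : 0 < t < 1 -> (1 - t) * (coord e.1 0)%:R + t * (coord e.2 0)%:R =
      (1 - s) * (coord f.1 0)%:R + s * (coord f.2 0)%:R :> R -> False.
  move=> t01 /=; rewrite e1 e2 f12 => E.
  by apply: (@nat_not_between R 0 f.2.1 t t01); rewrite E; ring.
apply/andP; split; apply/negP => /placed_crossP[t [s [t01 s01 E]]].
  exact: no (E 0%N isT).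
exact: no s01 (esym (E 0%N isT)).
Qed.

Lemma long_ends_inj e f : long e -> long f -> ends e = ends f -> e = f.
Proof.
case: e f => [[l p] [l' q]] [[m p'] [m' q']] /andP[/eqP/= e1 /eqP/= e2].
move=> /andP[/eqP/= f1 /eqP/= f2] [-> ->].
by congr ((_, _), (_, _)); apply: ord_inj; rewrite ?e1 ?e2 ?f1 ?f2.
Qed.

(** The bound [g < C] comes from a coordinate in which the first ends differ: they
    are congruent modulo [g] there and lie in a range of length at most [C].  If
    the first ends agreed, so would the second ones. *)
Lemma steep_of_meet (g h : nat) (ef : (box K C * box K C) * (box K C * box K C)) :
  (0 < h <= g)%N -> coprime g h -> meet_at g h ef.1 ef.2 -> ef.1 != ef.2 ->
  ef \in steep_meetings K C.
Proof.
case: ef => -[[[x y] z] q] [[[x' y'] z'] q'] hg co /= mt ne.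
have [B1 B2 B3] := and3P mt.
have g0 : (0 < g)%N by lia.
have ne1 : (x, y, z) != (x', y', z') :> box K C.
  apply: contraNneq ne => -[? ? ?]; subst x' y' z'.
  case: q q' B1 B2 B3 {mt} => [[u v] w] [[u' v'] w'] /= B1 B2 B3.
  have same (a b b' : nat) : balanced g h a b a b' -> b = b'.
    by apply: balanced_inj; rewrite // /balanced.
  by rewrite (ord_inj (same _ _ _ B1)) (ord_inj (same _ _ _ B2))
             (ord_inj (same _ _ _ B3)).
have KC' : (K <= C)%N by apply: leq_trans KC; rewrite -mulnn leq_pmulr.
have gC : (g < C)%N.
  rewrite ltnNge; apply: contra ne1 => Cg.
  have eqm (a c : nat) : (a < C)%N -> (c < C)%N -> (a == c %[mod g])%N -> a = c.
    by move=> aC cC; rewrite !modn_small ?(leq_trans _ Cg) // => /eqP.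
  apply/eqP; congr (_, _, _); apply: ord_inj.
  - by apply: eqm (balanced_mod co B1); apply: leq_trans KC'.
  - by apply: eqm (balanced_mod co B2); apply: leq_trans KC'.
  - exact: eqm (balanced_mod co B3).
have hC : (h < C)%N by lia.
rewrite inE ne1 /=; apply/existsP; exists (Ordinal gC); apply/existsP; exists (Ordinal hC).
by rewrite /= hg co.
Qed.

Definition swap_ends (e : box K C * box K C) := (e.2, e.1).

(** Since the layer coordinate runs at unit speed along every long edge, two of them
    meet at a common parameter, which is rational because the edges differ. *)
Lemma long_cross_steep e f : long e -> long f -> placed_cross R place e f ->
  ((ends e, ends f) \in steep_meetings K C) ||
  ((swap_ends (ends e), swap_ends (ends f)) \in steep_meetings K C).
Proof.
move=> le lf ef; have ne : ends e != ends f.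
  apply/eqP=> /(long_ends_inj le lf) E; by rewrite E placed_cross_irr in ef.
have [t [s [t01 s01 E]]] := placed_crossP ef.
have st : s = t.
  have := E 0%N isT; rewrite /=; case/andP: le => /eqP-> /eqP->.
  by case/andP: lf => /eqP-> /eqP->; lra.
rewrite {}st {s01} in E.
have [k k4 nek] : exists2 k, (k < 4)%N & coord e.1 k != coord f.1 k.
  apply: contrapT => no; case/eqP: ne.
  have E1 k : (k < 4)%N -> coord e.1 k = coord f.1 k.
    by move=> k4; apply/eqP; apply: contrapT => /negP ?; apply: no; exists k.
  have ee1 := coord_inj E1.
  have ee2 : e.2 = f.2.
    apply: coord_inj => k k4; have := E k k4; rewrite E1 // => /addrI/mulfI H.
    by apply/eqP; rewrite -(eqr_nat R); apply/eqP/H; lra.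
  by rewrite /ends ee1 ee2.
have [g [h [g0 h0 co Egh]]] := rational_crossing t01 nek (E k k4).
have mt : meet_at g h (ends e) (ends f).
  apply/and3P; split.
  - exact: crossing_balanced t01 Egh (E 1%N isT).
  - exact: crossing_balanced t01 Egh (E 2%N isT).
  - exact: crossing_balanced t01 Egh (E 3%N isT).
have [hg|gh] := leqP h g.
  by rewrite (@steep_of_meet g h) ?h0 ?hg.
apply/orP; right; rewrite (@steep_of_meet h g) ?g0 ?(ltnW gh) 1?coprime_sym //=.
  by move: mt; rewrite /meet_at /= !(@balanced_sym g h).
by apply: contra ne; case: (ends e) (ends f) => [a b] [a' b'] /eqP[-> ->].
Qed.

(** The steep meetings are counted once for each orientation.  Every pair of short
    edges may be allowed to cross: there are at most [2 K ^ 2 n] short edges, where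
    [n = K ^ 2 C], and [K ^ 4 <= n].  The upper bound on [C] turns the term [C ^ 2]
    of the steep count into a multiple of [n]. *)
Lemma card_box_crossings : (C <= 48 * K ^ 2)%N ->
  (#|related_pairs (placed_cross R place) (box_edges L K C)|
    <= 228 * (K ^ 2 * C) ^ 3)%N.
Proof.
move=> C48; have C0 : (0 < C)%N by apply: leq_trans KC; rewrite expn_gt0 K0.
pose Phi (ef : (point * point) * (point * point)) := (ends ef.1, ends ef.2).
pose Psi (ef : (point * point) * (point * point)) :=
  (swap_ends (ends ef.1), swap_ends (ends ef.2)).
pose LL := [set ef : (point * point) * (point * point) | long ef.1 && long ef.2].
pose A1 := LL :&: Phi @^-1: steep_meetings K C.
pose A2 := LL :&: Psi @^-1: steep_meetings K C.
have A1le : (#|A1| <= #|steep_meetings K C|)%N.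
  have inj : {in A1 &, injective Phi}.
    move=> [e f] [e' f']; rewrite !inE /= => /andP[/andP[? ?] _] /andP[/andP[? ?] _].
    by move=> E; congr pair; apply: long_ends_inj => //;
      [have := congr1 fst E|have := congr1 snd E].
  rewrite -(card_in_imset inj); apply/subset_leq_card/fintype.subsetP => _ /imsetP[x + ->].
  by rewrite !inE => /andP[_ ?].
have A2le : (#|A2| <= #|steep_meetings K C|)%N.
  have inj : {in A2 &, injective Psi}.
    have swapI a b : swap_ends a = swap_ends b -> a = b.
      by case: a b => [a a'] [b b'] [-> ->].
    move=> [e f] [e' f']; rewrite !inE /= => /andP[/andP[? ?] _] /andP[/andP[? ?] _].
    by move=> E; congr pair; apply: long_ends_inj => //; apply: swapI;
      [have := congr1 fst E|have := congr1 snd E].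
  rewrite -(card_in_imset inj); apply/subset_leq_card/fintype.subsetP => _ /imsetP[x + ->].
  by rewrite !inE => /andP[_ ?].
pose SS := finset.setX [set e | @short L K C e] [set e | @short L K C e].
apply: (@leq_trans (#|A1| + #|A2| + #|SS|)%N).
  apply: (@leq_trans #|A1 :|: A2 :|: SS|); last first.
    by apply: leq_trans (leq_card_setU _ _) _; rewrite leq_add2r leq_card_setU.
  apply/subset_leq_card/fintype.subsetP => -[e f].
  rewrite finset.in_set => /andP[/finset.setXP[/= De Df] ef]; rewrite !finset.in_setU.
  rewrite finset.in_set in De; rewrite finset.in_set in Df.
  case/orP: De => [le|se]; case/orP: Df => [lf|sf].
  - by apply/orP; left; case/orP: (long_cross_steep le lf ef) => H; apply/orP;
      [left|right]; rewrite finset.in_setI finset.in_set /= le lf finset.in_set.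
  - by have := long_short_no_cross le sf; rewrite ef.
  - by have := long_short_no_cross lf se; rewrite ef andbF.
  - by apply/orP; right; apply/finset.setXP; rewrite !finset.in_set.
have st := card_steep_meetings K0 C0.
rewrite cardsX; have sh := card_short_le L K C.
have sh2 : (#|[set e | @short L K C e]| <= 2 * (K ^ 2 * C) * K ^ 2)%N.
  by apply: leq_trans sh _; rewrite !leq_mul2r L2 !orbT.
apply: leq_trans (leq_add (leq_add A1le A2le) (leq_mul sh2 sh2)) _.
move: {A1le A2le sh sh2} #|_| st => s st; move: (K ^ 2)%N KC C48 st => k kC C48 st.
have : (2 * C ^ 2 <= 96 * (k * C))%N by nia.
move=> C2; have : (s <= (k * C) ^ 2 * (112 * (k * C)))%N.
  by apply: leq_trans st _; rewrite leq_mul2l; apply/orP; right; lia.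
have : (k * k <= k * C)%N by rewrite leq_mul2l kC orbT.
move: (k * C)%N => n kk sn.
have : (2 * n * k * (2 * n * k) <= 4 * n ^ 3)%N by nia.
by lia.
Qed.
End BoxGraph.

(** * Choice of the box and conclusion *)

(** Take [K] maximal with [6 K ^ 4 <= N + 2] and [C] the quotient of [N] by
    [2 K ^ 2].  Then [C + 1 >= 3 K ^ 2], which is what the short edges need to cover
    the deficit of order [N K ^ 2] left by rounding, and maximality of [K] bounds
    [C] from above.  For [N <= 3], where two layers may
    hold too few points, a single layer with [K = 1] is used: it is a path. *)
Lemma box_parameters (N : nat) : (0 < N)%N ->
  exists L K C : nat, [/\ (0 < L <= 2)%N, (0 < K)%N, (K ^ 2 <= C <= 48 * K ^ 2)%N,
    (L * (K ^ 2 * C) <= N)%N &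
    (N ^ 2 <= 4 * ((L - 1) * (K ^ 2 * C) ^ 2 + L * K ^ 4 * C.-1) + 3)%N].
Proof.
move=> N0; have [N3|N4] := leqP N 3.
  exists 1%N, 1%N, N; split => //; first by lia.
    by lia.
  by case: N N0 N3 => [|[|[|[|]]]].
have ex : exists K, (6 * K ^ 4 <= N + 2)%N by exists 1%N; lia.
have bd K : (6 * K ^ 4 <= N + 2)%N -> (K <= N + 2)%N.
  have : (K <= K ^ 4)%N by case: K => // K; rewrite -{1}(expn1 K.+1) leq_pexp2l.
  by lia.
have [K KN Kmax] := ex_maxnP ex bd.
have K0 : (0 < K)%N by apply: Kmax; lia.
have KN' : (N + 2 < 6 * K.+1 ^ 4)%N.
  by rewrite ltnNge; apply/negP => /Kmax; rewrite ltnn.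
have N96 : (N + 2 < 96 * K ^ 4)%N.
  apply: (leq_trans KN'); rewrite -[96%N]/(6 * 2 ^ 4)%N -mulnA leq_mul2l /=.
  by rewrite -expnMn leq_exp2r //; lia.
have k0 : (0 < 2 * K ^ 2)%N by rewrite muln_gt0 expn_gt0 K0.
exists 2, K, (N %/ (2 * K ^ 2))%N; have := div.leq_trunc_div N (2 * K ^ 2).
have := div.ltn_ceil N k0.
have E4 : (K ^ 4 = K ^ 2 * K ^ 2)%N by rewrite -expnD.
move: (divn N _) => C; rewrite {}E4 in KN N96 *.
have : (0 < K ^ 2)%N by rewrite expn_gt0 K0.
move: (K ^ 2)%N KN N96 => k KN N96 k1 N1 N2.
have C3 : (3 * k <= C.+1)%N by nia.
have C48 : (C <= 48 * k)%N by nia.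
split=> //; [by apply/andP; split; lia | by lia |].
have NN : (N <= 2 * k * C + 2 * k - 1)%N by lia.
have : (N ^ 2 <= (2 * k * C + 2 * k - 1) ^ 2)%N by rewrite leq_exp2r.
by case: C C3 {C48 N1 N2 NN} => [|C] C3; nia.
Qed.

(** A minimum over a nonempty set of graphs is attained because crossing numbers are
    natural numbers. *)
Lemma is_cr_d_le (R : realType) (d N m b : nat) (G : grid_graph d) :
  admissible R N m G -> (cr R G <= b)%N ->
  exists2 k, is_cr_d R d N m k & (k <= b)%N.
Proof.
move=> admG Gb.
pose P k := `[< exists G : grid_graph d, admissible R N m G /\ cr R G = k >].
have exP : exists k, P k by exists (cr R G); apply/asboolP; exists G.
have [k /asboolP Pk kmin] := ex_minnP exP.
exists k; first split=> // G' admG'.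
  by apply: kmin; apply/asboolP; exists G'.
by apply: leq_trans Gb; apply: kmin; apply/asboolP; exists G.
Qed.

(** As [E] is at least of order [N ^ 2], the ratio [X / (E (E - 1))] is of order
    [1 / N]. *)
Lemma thinned_ratio (N m E X k : nat) :
  (0 < N)%N -> (1 < m <= E)%N -> (N ^ 2 <= 4 * E + 3)%N -> (X <= 228 * N ^ 3)%N ->
  (k * (E * (E - 1)) <= X * (m * (m - 1)))%N -> (k * N <= 228 * 128 * m ^ 2)%N.
Proof.
move=> N0 /andP[m1 mE] NE XN kX.
have N3 : (0 < N ^ 3)%N by rewrite expn_gt0 N0.
have E8 : (N ^ 2 <= 8 * E)%N by lia.
have E2 : (E * E <= 2 * (E * (E - 1)))%N by nia.
have kE : (k * (E * E) <= 2 * (X * m ^ 2))%N.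
  apply: (@leq_trans (2 * (k * (E * (E - 1))))%N).
    by rewrite [leqRHS]mulnCA leq_mul2l E2 orbT.
  rewrite leq_mul2l /=; apply: (leq_trans kX).
  by rewrite leq_mul2l -mulnn leq_mul2l leq_subr !orbT.
have NN := leq_mul E8 E8.
rewrite -(leq_pmul2r N3).
apply: (@leq_trans (64 * (k * (E * E)))%N).
  have -> : (k * N * N ^ 3 = k * (N ^ 2 * N ^ 2))%N by lia.
  by apply: leq_trans (leq_mul (leqnn k) NN) _; lia.
apply: (@leq_trans (128 * (X * m ^ 2))%N); first by lia.
by have := leq_mul XN (leqnn (m ^ 2)); lia.
Qed.

Theorem theorem4 (R : realType) (d : nat) (hd : (4 <= d)%N) :
  exists C : R, forall N m : nat,
    (0 < N)%N -> m%:R <= N%:R ^+ 2 / 4 :> R ->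
    exists k : nat, is_cr_d R d N m k /\ k%:R <= C * (m%:R ^+ 2 / N%:R).
Proof.
(* 228 bounds the crossings of the dense graph over [N ^ 3]; 128 is what the
   inequalities [N ^ 2 <= 8 E] and [E <= 2 (E - 1)] cost in the thinning. *)
exists (228 * 128) => N m N0 mN.
have {}mN : (4 * m <= N ^ 2)%N by rewrite -(ler_nat R) natrM natrX; lra.
have [L [K [C [/andP[L0 L2] K0 /andP[KC C48] vN NE]]]] := box_parameters N0.
have Ege : ((L - 1) * (K ^ 2 * C) ^ 2 + L * K ^ 4 * C.-1 <= #|box_edges L K C|)%N.
  by apply: card_box_edges_ge; rewrite L0.
have mE : (m <= #|box_edges L K C|)%N by lia.
have [S [SD Sm Sx]] := thinning (placed_cross_irr R (@place d L K C)) mE.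
have Sasym p q : (p, q) \in S -> (q, p) \notin S.
  move=> /(fintype.subsetP SD)/box_edges_asym; apply: contra; exact: (fintype.subsetP SD).
pose G := placed_graph (@place_inj d hd L K C) (@place_gt0 d L K C) Sasym.
have adm : admissible R N m G.
  split.
  - by apply: placed_graph_proper => p q /(fintype.subsetP SD); apply: box_edges_step.
  - by rewrite card_placed_edges.
  - apply: leq_trans vN; rewrite -(prod_box_side hd).
    apply: vol_placed_graph => [i|p i]; last exact: place_le.
    case: (i : nat) => [|[|[|[|j]]]] //=.
    by apply: leq_trans KC; rewrite expn_gt0 K0.
have [k kcr kle] := is_cr_d_le adm (cr_placed_graph R _ _ Sasym).
exists k; split=> //.
suff : (k * N <= 228 * 128 * m ^ 2)%N.
  by rewrite mulrA ler_pdivlMr ?ltr0n // -natrX -!natrM ler_nat.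
have [m1|m2] := leqP m 1.
  move: kle; rewrite related_pairs_le1 ?Sm //; last exact: placed_cross_irr.
  by rewrite leqn0 => /eqP->.
have Xle := card_box_crossings R hd L2 K0 KC C48.
have nN : (K ^ 2 * C <= N)%N by apply: leq_trans vN; rewrite leq_pmull.
have {}Xle : (#|related_pairs (placed_cross R (@place d L K C)) (box_edges L K C)|
    <= 228 * N ^ 3)%N.
  by apply: leq_trans Xle _; rewrite leq_mul2l leq_exp2r // nN orbT.
apply: (thinned_ratio N0 _ _ Xle (leq_trans (leq_mul kle (leqnn _)) Sx)).
  by rewrite m2.
by apply: leq_trans NE _; rewrite leq_add2r leq_mul2l.
Qed.
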